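(* Let $M\ge1$. The quasi-1D moment system $$\acute{\vec B}_M^0(\acute{\vec W}_M)\frac{\partial\acute{\vec W}_M}{\partial t}+\acute{\vec B}_M^3(\acute{\vec W}_M)\frac{\partial\acute{\vec W}_M}{\partial x}=\acute{\vec S}(\acute{\vec W}_M)$$ with the Anderson-Witting source term is Lorentz covariant: for every boost $t'=\gamma(v)(t-vx)$, $x'=\gamma(v)(x-vt)$, $\gamma(v)=(1-v^2)^{-1/2}$, $|v|<1$, and every differentiable field $\acute{\vec W}_M(t,x)$ with $n>0$, $|u|<1$, $\theta>0$, $\acute{\vec W}_M$ satisfies the system in the variables $(t,x)$ if and only if the transformed field $\acute{\vec W}_M'(t',x')$ satisfies the same system in the variables $(t',x')$, i.e. $$\acute{\vec B}_M^0(\acute{\vec W}_M')\frac{\partial\acute{\vec W}_M'}{\partial t'}+\acute{\vec B}_M^3(\acute{\vec W}_M')\frac{\partial\acute{\vec W}_M'}{\partial x'}=\acute{\vec S}(\acute{\vec W}_M').$$ Here $\acute{\vec W}_M'$ is obtained from $\acute{\vec W}_M$ by replacing $u$ with $u'=\frac{u-v}{1-uv}$ (equivalently $(U^0)'=\gamma(U^0-vU^3)$, $(U^3)'=\gamma(U^3-vU^0)$) and leaving all other components (which are Lorentz scalars) unchanged, evaluated at the corresponding space-time point.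
   Context: **Notation.** Units with $c=m=1$. Spatial variable $x=x_3\in\mathbb{R}$, momentum $\vec p\in\mathbb{R}^3$, $p^0=\sqrt{1+|\vec p|^2}$. Velocity $\vec u=(0,0,u)$, $|u|<1$, $U^0=(1-u^2)^{-1/2}$, $U^3=U^0u$, $E=U^0p^0-U^3p^3$, $y=(E^2-1)^{-1/2}(U^0p^3-U^3p^0)$. For $\theta>0$, $\zeta=\theta^{-1}$: $g^{(0)}_{[\vec u,\theta]}=\frac{\zeta}{4\pi K_2(\zeta)}e^{-E/\theta}$ ($K_\nu$ modified Bessel functions of the second kind), $\langle f,g\rangle=\int_{\mathbb{R}^3}\frac{1}{g^{(0)}_{[\vec u,\theta]}}fg\frac{d^3\vec p}{p^0}$. $P_k^{(\ell)}(x;\zeta)$: degree-$k$ polynomials with leading coefficient $c_k^{(\ell)}>0$, orthonormal on $[1,\infty)$ for the weight $\frac{\zeta(x^2-1)^{\ell+1/2}}{(2\ell+1)K_2(\zeta)}e^{-\zeta x}$, with zeros $x_{1,k}^{(\ell)}<\dots<x_{k,k}^{(\ell)}$. $L_\ell$: Legendre polynomial. $\tilde P_{k,0}^{(\ell)}[\vec u,\theta]=g^{(0)}_{[\vec u,\theta]}P_k^{(\ell)}(E;\theta^{-1})(E^2-1)^{\ell/2}L_\ell(y)$. $\acute{\vec{\mathcal P}}_M$ is the vector of the $\acute N_M=\frac{(M+1)(M+2)}2$ orthonormal functions $\tilde P_{k,0}^{(\ell)}[\vec u,\theta]$, $k,\ell\ge0$, $k+\ell\le M$, in a fixed order, and $\acute\Pi_M[\vec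 u,\theta]f=\sum_{k+\ell\le M}\langle f,\tilde P_{k,0}^{(\ell)}\rangle\tilde P_{k,0}^{(\ell)}$. **State.** For $M=1$, $\acute{\vec W}_1=(n,u,\theta)$. For $M\ge2$, $\acute{\vec W}_M\in\mathbb{R}^{\acute N_M}$ consists of $n,u,\theta,\Pi,\tilde f_{0,0}^{(1)}$ and all $f_{k,0}^{(\ell)}$, $k+\ell\le M$, $(k,\ell)\notin\{(0,0),(1,0),(2,0),(0,1),(1,1)\}$. The remaining coefficients are (polynomials at $\zeta=\theta^{-1}$), for $M\ge2$, $$f_{0,0}^{(0)}=\frac{n}{c_0^{(0)}}-3c_0^{(0)}\Pi,\quad f_{1,0}^{(0)}=3c_1^{(0)}x_{1,1}^{(0)}\Pi,\quad f_{2,0}^{(0)}=-3c_2^{(0)}x_{1,2}^{(0)}x_{2,2}^{(0)}\Pi,\quad f_{0,0}^{(1)}=c_0^{(1)}\tilde f_{0,0}^{(1)},\quad f_{1,0}^{(1)}=-c_1^{(1)}x_{1,1}^{(1)}\tilde f_{0,0}^{(1)};$$ for $M=1$, $f_{0,0}^{(0)}=n/c_0^{(0)}$ and the others vanish. Let $\vec f_M$ be the vector of all $f_{k,0}^{(\ell)}$, $k+\ell\le M$, let $\vec f_M^{(0)}$ be the coefficient vector of $ng^{(0)}_{[\vec u,\theta]}$ (only nonzero entry $n/c_0^{(0)}$ for $(k,\ell)=(0,0)$), and $F=\sum_{k+\ell\le M}f_{k,0}^{(\ell)}\tilde P_{k,0}^{(\ell)}[\vec u,\theta]$. **System.** $\acute{\vec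 D}_M$ is the matrix whose $j$-th column is the coefficient vector, in the basis $\acute{\vec{\mathcal P}}_M$, of $\acute\Pi_M[\vec u,\theta]\big(\partial F/\partial(\acute{\vec W}_M)_j\big)$; $\acute{\vec M}_M^\alpha=\langle p^\alpha\acute{\vec{\mathcal P}}_M,\acute{\vec{\mathcal P}}_M^T\rangle$ and $\acute{\vec B}_M^\alpha=\acute{\vec M}_M^\alpha\acute{\vec D}_M$ for $\alpha=0,3$; $\acute{\vec S}=-\frac1\tau\langle E\acute{\vec{\mathcal P}}_M,\acute{\vec{\mathcal P}}_M^T\rangle(\vec f_M-\vec f_M^{(0)})$, where $\tau=\tau(n,\theta)>0$ is the relaxation time. *)

(* Defs.v *)
From mathcomp Require Import all_boot all_order all_algebra polyrcf zify lra ring.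
From mathcomp Require Import all_classical all_reals all_analysis.

Set Implicit Arguments.
Unset Strict Implicit.
Unset Printing Implicit Defensive.
Import Order.TTheory GRing.Theory Num.Theory.
Import numFieldNormedType.Exports.
Local Open Scope classical_set_scope.
Local Open Scope ring_scope.

(* K_nu(z), for z > 0, as the integral of cosh(nu s) exp(-z cosh s) over
   s >= 0. *)
Definition cosh {R : realType} (s : R) : R := (expR s + expR (- s)) / 2.

Definition besselK {R : realType} (nu z : R) : R :=
  \int[lebesgue_measure]_(s in `[0, +oo[) (cosh (nu * s) * expR (- z * cosh s)).

(* Rodrigues' formula. *)
Definition legendre (R : realType) (l : nat) : {poly R} :=
  (2 ^+ l * l`!%:R)^-1 *: (('X^2 - 1) ^+ l)^`(l).

Definition weight {R : realType} (l : nat) (z x : R) : R :=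
  z * powR (x ^+ 2 - 1) (l%:R + 2^-1) / ((2 * l + 1)%:R * besselK 2 z)
  * expR (- z * x).

Definition is_orthonormal_polys {R : realType} (w : R -> R)
    (P : nat -> {poly R}) : Prop :=
  [/\ forall k, size (P k) = k.+1,
      forall k, 0 < lead_coef (P k)
    & forall j k, \int[lebesgue_measure]_(x in `[1, +oo[)
        (w x * (P j).[x] * (P k).[x]) = (j == k)%:R].

(* P_k^(l)(.; z): for z > 0 the orthonormal family exists and is unique, so the
   default value of [xget] is not used. *)
Definition orthopoly {R : realType} (l : nat) (z : R) (k : nat) : {poly R} :=
  xget (fun=> 0 : {poly R}) [set P | is_orthonormal_polys (weight l z) P] k.

Definition leadc {R : realType} (k l : nat) (z : R) : R :=
  lead_coef (orthopoly l z k).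

(* x_{i,k}^(l); the index i starts from 1, and [rootsR] is increasing. *)
Definition zero {R : realType} (i k l : nat) (z : R) : R :=
  (rootsR (orthopoly l z k))`_i.-1.

(* A momentum (p^1, p^2, p^3) is encoded as ((p1, p2), p3). *)
Definition momentum (R : realType) : Type := (R * R * R)%type.

Definition p3 {R : realType} (p : momentum R) : R := p.2.

Definition p0 {R : realType} (p : momentum R) : R :=
  Num.sqrt (1 + p.1.1 ^+ 2 + p.1.2 ^+ 2 + p.2 ^+ 2).

Definition lorentz {R : realType} (v : R) : R := (Num.sqrt (1 - v ^+ 2))^-1.

Definition U0 {R : realType} (u : R) : R := lorentz u.

Definition U3 {R : realType} (u : R) : R := U0 u * u.

Definition energy {R : realType} (u : R) (p : momentum R) : R :=
  U0 u * p0 p - U3 u * p3 p.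

(* At the single momentum where energy u p = 1 this is 0, because 0^-1 = 0. *)
Definition ycos {R : realType} (u : R) (p : momentum R) : R :=
  (Num.sqrt (energy u p ^+ 2 - 1))^-1 * (U0 u * p3 p - U3 u * p0 p).

Definition equilibrium {R : realType} (u theta : R) (p : momentum R) : R :=
  theta^-1 / (4 * pi * besselK 2 theta^-1) * expR (- energy u p / theta).

Definition lebesgue3 (R : realType) :=
  ((@lebesgue_measure R \x @lebesgue_measure R) \x @lebesgue_measure R)%E.

Arguments lebesgue3 R : clear implicits.

Definition inner {R : realType} (u theta : R) (f g : momentum R -> R) : R :=
  \int[lebesgue3 R]_p ((equilibrium u theta p)^-1 * f p * g p / p0 p).

Definition Ptilde {R : realType} (u theta : R) (k l : nat) (p : momentum R) : R :=
  equilibrium u theta p * (orthopoly l theta^-1 k).[energy u p]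
  * Num.sqrt (energy u p ^+ 2 - 1) ^+ l * (legendre R l).[ycos u p].

(* The pairs (k, l) with k + l <= M in the order
   (0,0), (1,0), (0,1), (2,0), (1,1), (0,2), (3,0), ... *)
Definition indices (M : nat) : seq (nat * nat) :=
  flatten [seq [seq ((m - l)%N, l) | l <- iota 0 m.+1] | m <- iota 0 M.+1].

Definition nmom (M : nat) : nat := ((M.+1 * M.+2)./2)%N.

Lemma size_indices M : size (indices M) = nmom M.
Proof.
rewrite /nmom size_flatten /shape -map_comp sumnE big_map.
rewrite (eq_bigr succn) => [|m _]; last by rewrite /= size_map size_iota.
elim: M => [|M IH]; first by rewrite big_cons big_nil.
rewrite -[M.+2]addn1 iotaD big_cat IH big_seq1 add0n addn1.
have -> : (M.+2 * M.+3 = M.+1 * M.+2 + (M.+2).*2)%N by rewrite -mul2n; ring.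
by rewrite halfD odd_double andbF doubleK.
Qed.

Lemma mem_indices M k l : ((k, l) \in indices M) = (k + l <= M)%N.
Proof.
apply/flatten_mapP/idP => [[m]|le_kl].
  rewrite mem_iota add0n ltnS => /andP[_ le_mM].
  move=> /mapP[l']; rewrite mem_iota add0n ltnS => /andP[_ le_lm] [-> ->].
  by rewrite subnK.
exists (k + l)%N; first by rewrite mem_iota add0n ltnS.
apply/mapP; exists l; last by rewrite addnK.
by rewrite mem_iota add0n ltnS leq_addl.
Qed.

Lemma uniq_indices M : uniq (indices M).
Proof.
elim: M => [//|M IH].
rewrite /indices -[M.+2]addn1 iotaD map_cat flatten_cat -/(indices M) [flatten (map _ (iota _ 1))]cats0.
rewrite cat_uniq IH map_inj_in_uniq ?iota_uniq ?andbT; last by move=> x y _ _ [].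
apply/hasPn => _ /mapP[l ll ->]; rewrite mem_indices -ltnNge.
by move: ll; rewrite mem_iota => /andP[_ ll]; lia.
Qed.

Definition kl_of (M : nat) (i : 'I_(nmom M)) : nat * nat :=
  nth (0%N, 0%N) (indices M) i.

(* Components 0, ..., 4 are n, u, theta, Pi, tilde f_{0,0}^(1); component
   i >= 5 is f_{k,0}^(l) with (k, l) = kl_of i. This is consistent because the
   first five entries of [indices M] are the pairs that have no component of
   their own. For M = 1 only n, u, theta are present. *)
Definition state (R : realType) (M : nat) : Type := 'cV[R]_(nmom M).

Definition component {R : realType} {M : nat} (W : state R M) (i : nat) : R :=
  if insub i is Some j then W j 0 else 0.

Definition Wn {R : realType} {M : nat} (W : state R M) : R := component W 0.
Definition Wu {R : realType} {M : nat} (W : state R M) : R := component W 1.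
Definition Wtheta {R : realType} {M : nat} (W : state R M) : R := component W 2.
Definition WPi {R : realType} {M : nat} (W : state R M) : R := component W 3.
Definition Wf {R : realType} {M : nat} (W : state R M) : R := component W 4.

Definition admissible {R : realType} {M : nat} (W : state R M) : Prop :=
  [/\ 0 < Wn W, `|Wu W| < 1 & 0 < Wtheta W].

Definition eqcoefs {R : realType} {M : nat} (W : state R M) : 'cV[R]_(nmom M) :=
  \col_i if kl_of i == (0, 0)%N then Wn W / leadc 0 0 (Wtheta W)^-1 else 0.

Definition coefs {R : realType} {M : nat} (W : state R M) : 'cV[R]_(nmom M) :=
  let z := (Wtheta W)^-1 in
  if (M <= 1)%N then eqcoefs W else
  \col_i match kl_of i with
  | (0, 0)%N => Wn W / leadc 0 0 z - 3 * leadc 0 0 z * WPi W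
  | (1, 0)%N => 3 * leadc 1 0 z * zero 1 1 0 z * WPi W
  | (2, 0)%N => - 3 * leadc 2 0 z * zero 1 2 0 z * zero 2 2 0 z * WPi W
  | (0, 1)%N => leadc 0 1 z * Wf W
  | (1, 1)%N => - leadc 1 1 z * zero 1 1 1 z * Wf W
  | _ => W i 0
  end.

Definition basis {R : realType} {M : nat} (u theta : R) (i : 'I_(nmom M)) :
    momentum R -> R :=
  Ptilde u theta (kl_of i).1 (kl_of i).2.

Definition distribution_fun {R : realType} {M : nat} (W : state R M)
    (p : momentum R) : R :=
  \sum_i coefs W i 0 * basis (Wu W) (Wtheta W) i p.

Definition proj {R : realType} (M : nat) (u theta : R) (f : momentum R -> R) :
    momentum R -> R :=
  fun p => \sum_(i < nmom M) inner u theta f (basis u theta i) * basis u theta i p.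

Definition partialF {R : realType} {M : nat} (W : state R M)
    (j : 'I_(nmom M)) : momentum R -> R :=
  fun p => 'D_(delta_mx j 0 : 'cV[R]_(nmom M))
             (fun V : 'cV[R]_(nmom M) => distribution_fun V p) W.

Definition Dmx {R : realType} {M : nat} (W : state R M) : 'M[R]_(nmom M) :=
  \matrix_(i, j) inner (Wu W) (Wtheta W) (partialF W j) (basis (Wu W) (Wtheta W) i).

Lemma Dmx_coordinates (R : realType) (M : nat) (W : state R M) j p :
  proj M (Wu W) (Wtheta W) (partialF W j) p =
  \sum_i Dmx W i j * basis (Wu W) (Wtheta W) i p.
Proof. by apply: eq_bigr => i _; rewrite mxE. Qed.

(* <a P, P^T> for a scalar function a of the momentum. *)
Definition moment_mx {R : realType} {M : nat} (a : momentum R -> R)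
    (W : state R M) : 'M[R]_(nmom M) :=
  \matrix_(i, j) inner (Wu W) (Wtheta W)
    (fun p => a p * basis (Wu W) (Wtheta W) i p) (basis (Wu W) (Wtheta W) j).

Definition B0 {R : realType} {M : nat} (W : state R M) : 'M[R]_(nmom M) :=
  moment_mx p0 W *m Dmx W.

Definition B3 {R : realType} {M : nat} (W : state R M) : 'M[R]_(nmom M) :=
  moment_mx p3 W *m Dmx W.

Definition source {R : realType} {M : nat} (tau : R -> R -> R) (W : state R M) :
    'cV[R]_(nmom M) :=
  - (tau (Wn W) (Wtheta W))^-1 *:
    (moment_mx (energy (Wu W)) W *m (coefs W - eqcoefs W)).

(* Space-time points are pairs (t, x). *)
Definition solves {R : realType} {M : nat} (tau : R -> R -> R)
    (Omega : set (R * R)) (W : R * R -> 'cV[R]_(nmom M)) : Prop :=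
  forall z, Omega z ->
    B0 (W z) *m 'D_((1, 0) : R * R) W z + B3 (W z) *m 'D_((0, 1) : R * R) W z
    = source tau (W z).

Definition boost {R : realType} (v : R) (z : R * R) : R * R :=
  (lorentz v * (z.1 - v * z.2), lorentz v * (z.2 - v * z.1)).

Definition boost_state {R : realType} {M : nat} (v : R) (W : state R M) :
    'cV[R]_(nmom M) :=
  \col_i if val i == 1%N then (Wu W - v) / (1 - Wu W * v) else W i 0.

(* boost (- v) is the inverse of boost v. *)
Definition boost_field {R : realType} {M : nat} (v : R)
    (W : R * R -> 'cV[R]_(nmom M)) : R * R -> 'cV[R]_(nmom M) :=
  fun z => boost_state v (W (boost (- v) z)).

Lemma boostK (R : realType) (v : R) : `|v| < 1 -> cancel (boost v) (boost (- v)).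
Proof.
rewrite ltr_norml => /andP[v1 v2] [t x].
have v0 : 0 < 1 - v ^+ 2 by nra.
have g2 : lorentz v * lorentz v * (1 - v ^+ 2) = 1.
  by rewrite /lorentz -invfM -expr2 sqr_sqrtr ?ltW // mulVf // gt_eqF.
rewrite /boost /=.
have -> : lorentz (- v) = lorentz v by rewrite /lorentz sqrrN.
congr (_, _).
  by rewrite -[RHS]mul1r -g2; ring.
by rewrite -[RHS]mul1r -g2; ring.
Qed.

(* Main.v *)
From HB Require Import structures.
From mathcomp Require Import all_boot all_order all_algebra zify lra ring.
From mathcomp Require Import all_classical all_reals all_analysis measurable_realfun.
Require Import Defs.

(** Covariance holds because every object of the system is a boost-invariant
    integral over momentum space.  A boost of velocity v acts on momenta by
    [pboost v] and on states by [boost_state v]; with both acting at once the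
    energy, the angular variable y, the equilibrium and hence all basis
    functions and the distribution function F are unchanged
    ([energy_pboost], [Ptilde_pboost], [distribution_fun_pboost]), while p^0
    and p^3 mix as gamma (p^0 - v p^3) and gamma (p^3 - v p^0).

    The measure d^3p / p^0 is invariant under [pboost v].  In the variable p^3
    the boost is an increasing diffeomorphism of the line whose derivative is
    the ratio of the new p^0 to the old one; the one-dimensional substitution
    rule for Borel sets and Tonelli's theorem give the claim
    ([Rintegral_pboost]).  Consequently the inner product is invariant
    ([inner_pboost]), so the matrices <p^0 P, P^T> and <p^3 P, P^T> mix like p^0
    and p^3 ([moment_mx_p0_boost], [moment_mx_p3_boost]), and the source term,
    which involves only the scalar E, is unchanged ([source_boost_state]).
    Splitting <gamma (p^0 - v p^3) P, P^T> into two integrals requires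
    integrability: relatively to the equilibrium everything is bounded by a
    power of p^0, and the exponential decay of the equilibrium wins against
    any such power ([integrable_poly_bounded]).

    The matrix D transforms by the Jacobian of the change of state.  That
    Jacobian is diagonal: 1 in all directions except u, where it is the
    derivative of u |-> (u - v) / (1 - u v).  Hence D at the boosted state times
    the Jacobian is D at the original state ([Dmx_boost_state]).  The existence
    of the derivatives of F is a delicate point: the dependence of the
    orthogonal polynomials on theta is implicit, and differentiating F in theta
    would require the theory of these polynomials.  It is avoided
    altogether.  Along all directions but u the two difference quotients are
    literally equal; along u they differ by composition with a diffeomorphism,
    under which F either is derivable on both sides, and the chain rule
    applies, or on neither, and then both derivatives take the same default
    value 0 ([derive_comp_diffeo]).  For the same reason the derivatives of F
    are not known to be measurable functions of the momentum, so the invariance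
    of the integral is proved for arbitrary integrands, from the description of
    the integral as a supremum over simple functions below the integrand
    ([ge0_integral_change_of_variables]).

    Finally, the time and space derivatives of the boosted field are the Jacobian
    applied to gamma (d_t + v d_x) W and gamma (d_x + v d_t) W
    ([derive_boost_field]), and in B^0 d_t W + B^3 d_x W the mixed terms cancel,
    leaving the factor gamma^2 (1 - v^2) = 1 ([flux_combination]).  So both sides
    of the system have the same value at corresponding points. *)

Set Implicit Arguments.
Unset Strict Implicit.
Unset Printing Implicit Defensive.
Import Order.TTheory GRing.Theory Num.Theory.
Import numFieldNormedType.Exports.
Local Open Scope classical_set_scope.
Local Open Scope ring_scope.

(** * Change of variables for integrands that need not be measurable *)

Import HBNNSimple.

(** The integral of a nonnegative function is a supremum over the simple
    functions below it, and that set of simple functions grows with the function. *)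
Lemma ge0_le_integral_nonmeasurable d (T : measurableType d) (R : realType)
    (mu : {measure set T -> \bar R}) (f g : T -> \bar R) :
  (forall x, 0 <= f x)%E -> (forall x, f x <= g x)%E ->
  (\int[mu]_x f x <= \int[mu]_x g x)%E.
Proof.
move=> f0 fg; have g0 x : (0 <= g x)%E by exact: le_trans (fg x).
rewrite !ge0_integralTE//; apply: le_ereal_sup => _ [h hf <-].
by exists h => // x; exact: le_trans (hf x) (fg x).
Qed.

Lemma ge0_integral_le_nnsfun d (T : measurableType d) (R : realType)
    (mu : {measure set T -> \bar R}) (f : T -> \bar R) (c : \bar R) :
  (forall x, 0 <= f x)%E ->
  (forall h : {nnsfun T >-> R}, (forall x, (h x)%:E <= f x)%E ->
     (\int[mu]_x (h x)%:E <= c)%E) ->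
  (\int[mu]_x f x <= c)%E.
Proof.
move=> f0 hc; rewrite ge0_integralTE//; apply/ge_ereal_sup => _ [h hf <-].
by move: (hc h hf); rewrite integral_nnsfun// patch_setT.
Qed.

Section change_of_variables.
Context d (T : measurableType d) (R : realType).
Variables (mu : {measure set T -> \bar R}) (phi : T -> T) (J : T -> R).
Hypotheses (mphi : measurable_fun setT phi) (mJ : measurable_fun setT J).
Hypothesis J_ge0 : forall x, 0 <= J x.
Hypothesis mu_phi : forall E, measurable E ->
  mu E = (\int[mu]_x (\1_E (phi x) * J x)%:E)%E.

(** By linearity, the hypothesis on measurable sets extends to simple
    functions. *)
Lemma nnsfun_change_of_variables (h : {nnsfun T >-> R}) :
  (\int[mu]_x (h x)%:E = \int[mu]_x (h (phi x) * J x)%:E)%E.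
Proof.
under [LHS]eq_integral do rewrite fimfunE -fsumEFin//.
rewrite [LHS]ge0_integral_fsum//; last 2 first.
  - by move=> r; exact/measurable_EFinP/measurableT_comp.
  - by move=> n x _; rewrite EFinM nnfun_muleindic_ge0.
under [RHS]eq_integral.
  move=> x xD; rewrite EFinM muleC fimfunE -fsumEFin// ge0_mule_fsumr; last first.
    by move=> r; rewrite EFinM nnfun_muleindic_ge0.
  over.
have mI r : measurable_fun [set: T] (fun x => \1_(h @^-1` [set r]) (phi x) : R).
  by apply: measurableT_comp => //; exact: measurable_indic.
rewrite [RHS]ge0_integral_fsum//; last 2 first.
  - move=> r; apply/measurable_EFinP; apply: measurable_funM => //.
    by apply: measurable_funM.
  - move=> r x _; apply: mule_ge0; first by rewrite lee_fin.
    by rewrite EFinM nnfun_muleindic_ge0.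
apply: eq_fsbigr => r /[!inE] -[y _ <-].
under [RHS]eq_integral do rewrite -EFinM mulrCA [J _ * _]mulrC EFinM.
rewrite integralZl_indic_nnsfun// integral_indic// setIT mu_phi//.
rewrite -ge0_integralZl//.
- by apply/measurable_EFinP; apply: measurable_funM.
- by move=> x _; rewrite lee_fin mulr_ge0.
- by rewrite lee_fin.
Qed.

(** For a simple function h below f, the function h (phi x) J x has the same
    integral as h and is below f (phi x) J x. *)
Lemma ge0_integral_le_change_of_variables (f : T -> \bar R) :
  (forall x, 0 <= f x)%E ->
  (\int[mu]_x f x <= \int[mu]_x (f (phi x) * (J x)%:E))%E.
Proof.
move=> f0; apply: ge0_integral_le_nnsfun => // h hf.
rewrite nnsfun_change_of_variables; apply: ge0_le_integral_nonmeasurable => x.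
  by rewrite lee_fin mulr_ge0.
by rewrite EFinM lee_wpmul2r// lee_fin.
Qed.

End change_of_variables.

(** The reverse of [ge0_integral_le_change_of_variables] is the same inequality
    for the inverse substitution psi, applied to the right-hand integrand. *)
Lemma ge0_integral_change_of_variables d (T : measurableType d) (R : realType)
    (mu : {measure set T -> \bar R}) (phi psi : T -> T) (J K : T -> R) :
  measurable_fun setT phi -> measurable_fun setT psi ->
  measurable_fun setT J -> measurable_fun setT K ->
  (forall x, 0 <= J x) -> (forall x, 0 <= K x) ->
  (forall E, measurable E -> mu E = (\int[mu]_x (\1_E (phi x) * J x)%:E)%E) ->
  (forall E, measurable E -> mu E = (\int[mu]_x (\1_E (psi x) * K x)%:E)%E) ->
  cancel psi phi -> (forall x, J (psi x) * K x = 1) ->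
  forall f : T -> \bar R, (forall x, 0 <= f x)%E ->
  (\int[mu]_x f x = \int[mu]_x (f (phi x) * (J x)%:E))%E.
Proof.
move=> mphi mpsi mJ mK J0 K0 muphi mupsi psiK JK f f0.
apply/eqP; rewrite eq_le; apply/andP; split.
  exact: ge0_integral_le_change_of_variables.
have /= := @ge0_integral_le_change_of_variables _ _ _ mu _ _ mpsi mK K0 mupsi
  (fun x => f (phi x) * (J x)%:E)%E.
under [X in (_ -> _ <= X)%E -> _]eq_integral do
  rewrite psiK -muleA -EFinM JK mule1.
by apply => x; rewrite mule_ge0// lee_fin.
Qed.

(** Scaling by c maps the simple functions below f onto those below c f; the two
    inequalities are the same statement for c and for its inverse. *)
Lemma ge0_integralZ_nonmeasurable d (T : measurableType d) (R : realType)
    (mu : {measure set T -> \bar R}) (c : R) (f : T -> \bar R) :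
  0 < c -> (forall x, 0 <= f x)%E ->
  (\int[mu]_x (c%:E * f x) = c%:E * \int[mu]_x f x)%E.
Proof.
have main (k : R) (g : T -> \bar R) : 0 < k -> (forall x, 0 <= g x)%E ->
    (k%:E * \int[mu]_x g x <= \int[mu]_x (k%:E * g x))%E.
  move=> k0 g0; rewrite -lee_pdivlMl//.
  apply: ge0_integral_le_nnsfun => // h hg.
  rewrite lee_pdivlMl// -ge0_integralZl//; last 3 first.
  - exact/measurable_EFinP.
  - by move=> x _; rewrite lee_fin.
  - by rewrite lee_fin ltW.
  apply: ge0_le_integral_nonmeasurable => x; first by rewrite mule_ge0// lee_fin// ltW.
  by rewrite lee_pmul2l// lte_fin.
move=> c0 f0; apply/eqP; rewrite eq_le main// andbT.
rewrite -lee_pdivrMl//.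
apply: (le_trans (main _ _ _ _)); rewrite ?invr_gt0//.
  by move=> x; rewrite mule_ge0// lee_fin ltW.
apply: ge0_le_integral_nonmeasurable => x.
  by rewrite !mule_ge0// lee_fin ltW// invr_gt0.
by rewrite muleA -EFinM mulVf ?gt_eqF// mul1e.
Qed.

Lemma Rintegral_change_of_variables d (T : measurableType d) (R : realType)
    (mu : {measure set T -> \bar R}) (phi : T -> T) (J : T -> R) :
  (forall x, 0 <= J x) ->
  (forall f : T -> \bar R, (forall x, 0 <= f x)%E ->
    (\int[mu]_x f x = \int[mu]_x (f (phi x) * (J x)%:E))%E) ->
  forall f : T -> R, \int[mu]_x f x = \int[mu]_x (f (phi x) * J x).
Proof.
move=> J0 H f; rewrite /Rintegral integralE [in RHS]integralE.
congr (fine (_ - _)%E).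
  rewrite H//; apply: eq_integral => x _ /=.
  by rewrite !funeposE/= EFinM maxe_pMl ?mul0e// lee_fin.
rewrite H//; apply: eq_integral => x _ /=.
by rewrite !funenegE/= maxe_pMl ?mul0e// ?lee_fin// -EFinM mulNr.
Qed.

Lemma RintegralZ_nonmeasurable d (T : measurableType d) (R : realType)
    (mu : {measure set T -> \bar R}) (c : R) (f : T -> R) :
  0 < c -> \int[mu]_x (c * f x) = c * \int[mu]_x f x.
Proof.
move=> c0; rewrite /Rintegral integralE [in RHS]integralE.
have -> : (\int[mu]_x ((fun x => (c * f x)%:E)^\+ x) =
           c%:E * \int[mu]_x ((fun x => (f x)%:E)^\+ x))%E.
  rewrite -ge0_integralZ_nonmeasurable//; apply: eq_integral => x _.
  by rewrite !funeposE/= EFinM maxe_pMr ?mule0// lee_fin ltW.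
have -> : (\int[mu]_x ((fun x => (c * f x)%:E)^\- x) =
           c%:E * \int[mu]_x ((fun x => (f x)%:E)^\- x))%E.
  rewrite -ge0_integralZ_nonmeasurable//; apply: eq_integral => x _.
  by rewrite !funenegE/= maxe_pMr ?mule0// ?lee_fin ?ltW// -EFinM mulrN.
have c0' : (0 < c%:E)%E by rewrite lte_fin.
have : (0 <= \int[mu]_x ((fun x => (f x)%:E)^\+ x))%E.
  by apply: integral_ge0 => x _; exact: funepos_ge0.
have : (0 <= \int[mu]_x ((fun x => (f x)%:E)^\- x))%E.
  by apply: integral_ge0 => x _; exact: funeneg_ge0.
case: (integral _ _ _) => [b| |] //; case: (integral _ _ _) => [a| |] // _ _;
  rewrite ?gt0_muley// /= ?mulr0 //.
by rewrite mulrBr.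
Qed.

(** * Substitution on the real line for Borel sets *)

(** The image under phi of the measure with density f. *)
Definition density_pushforward (R : realType) (phi f : R -> R) (A : set R) :
    \bar R :=
  (\int[lebesgue_measure]_(s in phi @^-1` A) (f s)%:E)%E.

Section density_pushforward_measure.
Context (R : realType) (phi f : R -> R).
Hypotheses (f_ge0 : forall s, 0 <= f s).
Hypotheses (mf : measurable_fun setT f) (mphi : measurable_fun setT phi).

Let nu := density_pushforward phi f : set (measurableTypeR R) -> \bar R.

Let nu0 : nu set0 = 0%E.
Proof. by rewrite /nu /density_pushforward preimage_set0 integral_set0. Qed.

Let nu_ge0 A : (0 <= nu A)%E.
Proof. by apply: integral_ge0 => s _; rewrite lee_fin. Qed.

Let nu_sigma_additive : semi_sigma_additive nu.
Proof.
move=> /= F mF tF mUF; rewrite /nu /density_pushforward; apply: cvg_toP.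
  apply: ereal_nondecreasing_is_cvgn => m n mn.
  by apply: lee_sum_nneg_natr => // k _ _; apply: nu_ge0.
rewrite preimage_bigcup ge0_integral_bigcup//=.
- by move=> k; rewrite -[_ @^-1` _]setTI; apply: mphi => //; exact: mF.
- exact/measurable_EFinP/measurable_funTS.
- by move=> s _; rewrite lee_fin.
- apply/trivIsetP => i j _ _ ij; rewrite -preimage_setI.
  by move/trivIsetP : tF => tF; rewrite tF// preimage_set0.
Qed.

HB.instance Definition _ :=
  isMeasure.Build _ _ _ nu nu0 nu_ge0 nu_sigma_additive.

(** Lebesgue measure is determined by its values on half-open intervals. *)
Lemma lebesgue_measure_density_pushforward :
  (forall a b, a < b ->
     density_pushforward phi f `]a, b]%classic = (b - a)%:E) ->
  forall A, measurable A -> lebesgue_measure A = nu A.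
Proof.
move=> H A mA; apply: (@lebesgue_measure_unique _ nu) => //.
move=> X /ocitvP[->|[[a b] /= ab ->]]; first by rewrite !measure0.
by rewrite lebesgue_measure_itv/= lte_fin ab -EFinB -H.
Qed.

End density_pushforward_measure.

(** The preimage of an interval under phi is an interval, and the fundamental
    theorem of calculus evaluates the integral of f over it; the case of Borel
    sets follows by uniqueness of Lebesgue measure. *)
Lemma lebesgue_measure_substitution (R : realType) (phi psi f : R -> R) :
  (forall s, 0 <= f s) -> continuous f -> (forall s : R, is_derive s 1 phi (f s)) ->
  {homo phi : x y / x < y} -> cancel psi phi ->
  forall A : set (measurableTypeR R), measurable A ->
  lebesgue_measure A = (\int[lebesgue_measure]_s (\1_A (phi s) * f s)%:E)%E.
Proof.
move=> f0 cf dphi incr psiK A mA.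
have cphi : continuous phi.
  move=> x; have [d _] := dphi x.
  exact/differentiable_continuous/derivable1_diffP.
have mphi : measurable_fun setT phi by exact: continuous_measurable_fun.
have mf : measurable_fun setT f by exact: continuous_measurable_fun.
have mono := leW_mono (le_mono incr).
rewrite (lebesgue_measure_density_pushforward f0 mf mphi) //.
  rewrite /density_pushforward integral_mkcond; apply: eq_integral => s _.
  rewrite patchE indicE; case: ifPn => [|]; rewrite !(inE,notin_setE) /=.
    by move=> Aphi; rewrite mem_set// mul1r.
  by move=> Aphi; rewrite memNset// mul0r.
move=> a b ab; rewrite /density_pushforward.
have -> : phi @^-1` `]a, b]%classic = `]psi a, psi b]%classic.
  apply/funext => s; rewrite /= !in_itv/=.
  by rewrite -(mono (psi a)) -(le_mono incr s) !psiK.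
have psiab : psi a < psi b by rewrite -mono !psiK.
rewrite integral_itv_obnd_cbnd; last exact/measurable_EFinP/measurable_funTS.
rewrite (@continuous_FTC2 _ f phi)// ?psiK//.
- by apply: continuous_subspaceT => x; apply: cf.
- split.
  + by move=> x _; have [] := dphi x.
  + by apply: cvg_at_right_filter; exact: cphi.
  + by apply: cvg_at_left_filter; exact: cphi.
- by move=> x _; rewrite derive1E; have [_ ->] := dphi x.
Qed.

(** * Kinematics of the boost *)

(** The boosted momentum is written in the coordinates (p^1, p^2, p^3); its p^0 is
    then given by the mass-shell relation, see [p0_pboost]. *)
Definition pboost (R : realType) (v : R) (p : momentum R) : momentum R :=
  (p.1, lorentz v * (p3 p - v * p0 p)).

(** The derivative of the boosted p^3 with respect to p^3: this quotient form
    is what makes d^3p / p^0 invariant. *)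
Definition pboost_jac (R : realType) (v : R) (p : momentum R) : R :=
  p0 (pboost v p) / p0 p.

Section lorentz_kinematics.
Variable R : realType.
Implicit Types (u v : R) (p : momentum R).

Lemma lorentzN v : lorentz (- v) = lorentz v.
Proof. by rewrite /lorentz sqrrN. Qed.

Lemma oneBsqr_gt0 v : `|v| < 1 -> 0 < 1 - v ^+ 2.
Proof. by rewrite ltr_norml => /andP[? ?]; nra. Qed.

Lemma lorentz_gt0 v : `|v| < 1 -> 0 < lorentz v.
Proof. by move=> /oneBsqr_gt0 v0; rewrite invr_gt0 sqrtr_gt0. Qed.

Lemma lorentz_sqr v : `|v| < 1 -> lorentz v ^+ 2 * (1 - v ^+ 2) = 1.
Proof.
move=> /oneBsqr_gt0 v0.
by rewrite exprVn sqr_sqrtr ?mulVf ?gt_eqF// ltW.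
Qed.

Lemma oneBM_gt0 u v : `|u| < 1 -> `|v| < 1 -> 0 < 1 - u * v.
Proof. by rewrite !ltr_norml => /andP[? ?] /andP[? ?]; nra. Qed.

(** The relativistic velocity addition that [boost_state] applies to u. *)
Definition vadd v u : R := (u - v) / (1 - u * v).

Lemma vadd_lt1 u v : `|u| < 1 -> `|v| < 1 -> `|vadd v u| < 1.
Proof.
move=> u1 v1; have d0 := oneBM_gt0 u1 v1.
move: u1 v1; rewrite !ltr_norml => /andP[? ?] /andP[? ?].
by rewrite ltr_pdivlMr// ltr_pdivrMr//; apply/andP; split; nra.
Qed.

Lemma vaddK v u : `|u| < 1 -> `|v| < 1 -> vadd (- v) (vadd v u) = u.
Proof.
move=> u1 v1; have d0 := oneBM_gt0 u1 v1; have v0 := oneBsqr_gt0 v1.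
have d1 : 1 - u * v != 0 by rewrite gt_eqF.
have v2 : 1 - v ^+ 2 != 0 by rewrite gt_eqF.
have num : vadd v u - - v = u * (1 - v ^+ 2) / (1 - u * v).
  by rewrite /vadd; field.
have den : 1 - vadd v u * - v = (1 - v ^+ 2) / (1 - u * v).
  by rewrite /vadd; field.
by rewrite {1}/vadd num den; field; apply/andP.
Qed.

Lemma U0_vadd u v : `|u| < 1 -> `|v| < 1 ->
  U0 (vadd v u) = lorentz v * (U0 u - v * U3 u).
Proof.
move=> u1 v1; have d0 := oneBM_gt0 u1 v1.
have lu := lorentz_sqr u1; have lv := lorentz_sqr v1.
have lw := lorentz_sqr (vadd_lt1 u1 v1).
have gu := lorentz_gt0 u1; have gv := lorentz_gt0 v1.
have gw := lorentz_gt0 (vadd_lt1 u1 v1).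
rewrite /U3 /U0; set g := lorentz _ in lw gw *.
have -> : lorentz v * (lorentz u - v * (lorentz u * u)) =
          lorentz v * lorentz u * (1 - u * v) by ring.
have h0 : 0 < lorentz v * lorentz u * (1 - u * v) by rewrite !mulr_gt0.
apply/eqP; rewrite -(@eqrXn2 _ 2) ?ltW//; apply/eqP.
have w0 := oneBsqr_gt0 (vadd_lt1 u1 v1).
apply: (@mulIf _ (1 - vadd v u ^+ 2)); rewrite ?lw ?gt_eqF//.
have -> : 1 - vadd v u ^+ 2 = (1 - u ^+ 2) * (1 - v ^+ 2) / (1 - u * v) ^+ 2.
  by rewrite /vadd; field; rewrite gt_eqF.
set e := _ * _.
have -> : e = (lorentz u ^+ 2 * (1 - u ^+ 2)) * (lorentz v ^+ 2 * (1 - v ^+ 2)).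
  by rewrite /e; field; rewrite gt_eqF.
by rewrite lu lv mulr1.
Qed.

Lemma U3_vadd u v : `|u| < 1 -> `|v| < 1 ->
  U3 (vadd v u) = lorentz v * (U3 u - v * U0 u).
Proof.
move=> u1 v1; have d0 := oneBM_gt0 u1 v1.
rewrite [LHS]/U3 U0_vadd// /U3 /vadd; field.
by rewrite gt_eqF.
Qed.

Lemma p0_arg_ge1 p : 1 <= 1 + p.1.1 ^+ 2 + p.1.2 ^+ 2 + p.2 ^+ 2.
Proof. by rewrite -!addrA lerDl !addr_ge0// sqr_ge0. Qed.

Lemma p0_sqr p : p0 p ^+ 2 = 1 + p.1.1 ^+ 2 + p.1.2 ^+ 2 + p.2 ^+ 2.
Proof. by rewrite sqr_sqrtr// (le_trans ler01 (p0_arg_ge1 p)). Qed.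

Lemma p0_ge1 p : 1 <= p0 p.
Proof. by rewrite -sqrtr1 ler_wsqrtr// p0_arg_ge1. Qed.

Lemma p0_gt0 p : 0 < p0 p.
Proof. exact: lt_le_trans (p0_ge1 p). Qed.

Lemma normr_p3_le p : `|p3 p| <= p0 p.
Proof.
rewrite -(@ler_pXn2r _ 2) ?nnegrE// ?(ltW (p0_gt0 p))//.
by rewrite p0_sqr real_normK ?num_real// lerDr !addr_ge0// sqr_ge0.
Qed.

Lemma p0_mulB_gt0 v p : `|v| < 1 -> 0 < p0 p - v * p3 p.
Proof.
move=> v1; rewrite subr_gt0 (le_lt_trans (ler_norm _))// normrM.
apply: (le_lt_trans (ler_wpM2l (normr_ge0 v) (normr_p3_le p))).
by rewrite gtr_pMl// p0_gt0.
Qed.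

Lemma p0_pboost v p : `|v| < 1 ->
  p0 (pboost v p) = lorentz v * (p0 p - v * p3 p).
Proof.
move=> v1; have g0 := lorentz_gt0 v1; have g2 := lorentz_sqr v1.
apply/eqP; rewrite -(@eqrXn2 _ 2) ?(ltW (p0_gt0 _))//; last first.
  by rewrite mulr_ge0// ltW// p0_mulB_gt0.
rewrite p0_sqr /= exprMn; apply/eqP.
have := p0_sqr p; rewrite /p3; set a := p0 p => a2.
have -> : 1 + p.1.1 ^+ 2 + p.1.2 ^+ 2 = a ^+ 2 - p.2 ^+ 2 by rewrite a2; ring.
by rewrite -[a ^+ 2 - _]mul1r -g2; ring.
Qed.

Lemma pboostK v : `|v| < 1 -> cancel (pboost v) (pboost (- v)).
Proof.
move=> v1 p; rewrite {1}/pboost p0_pboost// /= lorentzN.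
case: p => q s; congr (_, _); rewrite /p3/=.
have g2 := lorentz_sqr v1.
by rewrite -[RHS]mul1r -g2; ring.
Qed.

Lemma energy_pboost v u p : `|u| < 1 -> `|v| < 1 ->
  energy (vadd v u) (pboost v p) = energy u p.
Proof.
move=> u1 v1; rewrite /energy p0_pboost// U0_vadd// U3_vadd// /p3/=.
have g2 := lorentz_sqr v1.
by rewrite -[RHS]mul1r -g2 /p3; ring.
Qed.

Lemma ycos_pboost v u p : `|u| < 1 -> `|v| < 1 ->
  ycos (vadd v u) (pboost v p) = ycos u p.
Proof.
move=> u1 v1; rewrite /ycos energy_pboost// p0_pboost// U0_vadd// U3_vadd//.
congr (_ * _); have g2 := lorentz_sqr v1.
by rewrite -[RHS]mul1r -g2 /p3/=; ring.
Qed.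

Lemma equilibrium_pboost v u theta p : `|u| < 1 -> `|v| < 1 ->
  equilibrium (vadd v u) theta (pboost v p) = equilibrium u theta p.
Proof. by move=> u1 v1; rewrite /equilibrium energy_pboost. Qed.

Lemma Ptilde_pboost v u theta k l p : `|u| < 1 -> `|v| < 1 ->
  Ptilde (vadd v u) theta k l (pboost v p) = Ptilde u theta k l p.
Proof.
by move=> u1 v1; rewrite /Ptilde equilibrium_pboost// energy_pboost// ycos_pboost.
Qed.

Lemma normrN_lt1 v : `|v| < 1 -> `|- v| < 1.
Proof. by rewrite normrN. Qed.

Lemma measurable_p3 : measurable_fun setT (@p3 R).
Proof. exact: measurable_snd. Qed.

Lemma measurable_sqrt : measurable_fun setT (@Num.sqrt R).
Proof. by apply: continuous_measurable_fun => x; exact: sqrt_continuous. Qed.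

Lemma measurable_p0 : measurable_fun setT (@p0 R).
Proof.
apply: measurableT_comp; first exact: measurable_sqrt.
apply: measurable_funD; last by apply: measurable_funX; exact: measurable_snd.
apply: measurable_funD.
  apply: measurable_funD; first exact: measurable_cst.
  apply: measurable_funX; exact: (measurableT_comp measurable_fst measurable_fst).
apply: measurable_funX; exact: (measurableT_comp measurable_snd measurable_fst).
Qed.

Lemma measurable_invr : measurable_fun setT (@GRing.inv R).
Proof.
(* x^-1 = x (x^2)^-1 also at 0, and real powers are measurable functions. *)
have -> : @GRing.inv R = (fun x => x * (x ^+ 2) `^ (-1)).
  apply/funext => x; rewrite powR_inv1 ?sqr_ge0//.
  have [->|x0] := eqVneq x 0; first by rewrite invr0 mul0r.
  by field.
apply: measurable_funM; first exact: measurable_id.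
by apply: (measurableT_comp (measurable_powR _)); exact: measurable_funX.
Qed.

End lorentz_kinematics.

(** * Iterated integration over momentum space *)

(** The product of two Lebesgue measures under a name of its own, so that it can
    carry the sigma-finite structure that iterated integration asks for. *)
Definition lebesgue2 (R : realType) :
    set (measurableTypeR R * measurableTypeR R) -> \bar R :=
  (@lebesgue_measure R \x @lebesgue_measure R)%E.

HB.instance Definition _ (R : realType) := Measure.on (@lebesgue2 R).

Lemma sigma_finite_lebesgue2 (R : realType) : sigma_finite setT (@lebesgue2 R).
Proof.
pose I n : set (measurableTypeR R) := `[- n%:R, n%:R]%classic.
have mI n : measurable (I n) by exact: measurable_itv.
exists (fun n => I n `*` I n) => [|n].
  apply/esym; rewrite -subTset => -[x y] _.
  exists (Num.bound `|x| + Num.bound `|y|)%N => //=.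
  have x0 := archi_boundP (normr_ge0 x); have y0 := archi_boundP (normr_ge0 y).
  rewrite /I/= !in_itv/= -!ler_norml natrD.
  have ? : 0 <= (Num.bound `|x|)%:R :> R by [].
  have ? : 0 <= (Num.bound `|y|)%:R :> R by [].
  by split; lra.
split; first exact: measurableX.
rewrite /lebesgue2 product_measure1E// lte_mul_pinfty//.
  by rewrite ge0_fin_numE//= /I lebesgue_measure_itv/=; case: ifP; rewrite ?ltry.
by rewrite /= /I lebesgue_measure_itv/=; case: ifP; rewrite ?ltry.
Qed.

HB.instance Definition _ (R : realType) :=
  Measure_isSigmaFinite.Build _ _ _ (@lebesgue2 R) (@sigma_finite_lebesgue2 R).

Lemma lebesgue3_tonelli (R : realType) (f : momentum R -> \bar R) :
  measurable_fun setT f -> (forall p, 0 <= f p)%E ->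
  (\int[lebesgue3 R]_p f p =
   \int[@lebesgue2 R]_q \int[lebesgue_measure]_s f (q, s))%E.
Proof.
move=> mf f0.
exact: (@fubini_tonelli1 _ _ _ _ R (@lebesgue2 R) (@lebesgue_measure R) f mf f0).
Qed.

(** * Boost invariance of the measure on momentum space *)

Section boost_invariant_measure.
Variables (R : realType) (v : R).
Hypothesis v1 : `|v| < 1.
Implicit Types p : momentum R.

Lemma is_derive_p0 (q : R * R) (s : R) :
  is_derive s 1 (fun s : R => p0 ((q, s) : momentum R)) (s / p0 ((q, s) : momentum R)).
Proof.
have a0 : 0 < 1 + q.1 ^+ 2 + q.2 ^+ 2 + s ^+ 2.
  exact: lt_le_trans (p0_arg_ge1 ((q, s) : momentum R)).
have dg : is_derive s 1 (fun s : R => 1 + q.1 ^+ 2 + q.2 ^+ 2 + s ^+ 2) (2 * s).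
  by apply: is_derive_eq; rewrite /GRing.scale /=; ring.
have := @is_derive1_comp _ Num.sqrt _ s _ _ (is_derive1_sqrt a0) dg.
move=> d; apply: (is_derive_eq d); rewrite /p0 /=.
by field; rewrite gt_eqF// sqrtr_gt0.
Qed.

Lemma is_derive_pboost (q : R * R) (s : R) :
  is_derive s 1 (fun s : R => (pboost v ((q, s) : momentum R)).2)
    (pboost_jac v ((q, s) : momentum R)).
Proof.
have d0 := is_derive_p0 q s.
rewrite /pboost /p3 /=; apply: is_derive_eq.
rewrite /pboost_jac p0_pboost// /p3 /GRing.scale /=; field.
by rewrite gt_eqF// p0_gt0.
Qed.

Lemma pboost_jac_gt0 p : 0 < pboost_jac v p.
Proof. by rewrite divr_gt0// p0_gt0. Qed.

Lemma pboost_homo (q : R * R) :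
  {homo (fun s : R => (pboost v ((q, s) : momentum R)).2) : x y / x < y}.
Proof.
move=> x y xy; pose f (s : R) := (pboost v ((q, s) : momentum R)).2.
have df (z : R) : is_derive z 1 f (pboost_jac v ((q, z) : momentum R)).
  exact: is_derive_pboost.
change (f x < f y); apply: (@gtr0_derive1_incr _ f x y) => //.
- by move=> z _; rewrite derive1E; have [_ ->] := df z; exact: pboost_jac_gt0.
- apply: continuous_subspaceT => z; have [d _] := df z.
  exact/differentiable_continuous/derivable1_diffP.
Qed.

Lemma measurable_pboost : measurable_fun setT (pboost v).
Proof.
apply: measurable_fun_pair; first exact: measurable_fst.
apply: measurable_funM; first exact: measurable_cst.
apply: measurable_funB; first exact: measurable_p3.
by apply: measurable_funM; [exact: measurable_cst|exact: measurable_p0].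
Qed.

Lemma measurable_pboost_jac : measurable_fun setT (pboost_jac v).
Proof.
apply: measurable_funM.
  by apply: measurableT_comp; [exact: measurable_p0|exact: measurable_pboost].
by apply: measurableT_comp; [exact: measurable_invr|exact: measurable_p0].
Qed.

Lemma continuous_pboost_jac (q : R * R) :
  continuous (fun s : R => pboost_jac v ((q, s) : momentum R)).
Proof.
move=> s.
have cp : {for s, continuous (fun s : R => p0 ((q, s) : momentum R))}.
  have [d _] := is_derive_p0 q s.
  exact/differentiable_continuous/derivable1_diffP.
rewrite (_ : (fun _ => _) = (fun s : R => lorentz v *
  (p0 ((q, s) : momentum R) - v * s) / p0 ((q, s) : momentum R))); last first.
  by apply/funext => t; rewrite /pboost_jac p0_pboost.
apply: cvgM; last by apply: cvgV => //; rewrite gt_eqF// p0_gt0.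
apply: cvgM; first exact: cvg_cst.
by apply: cvgB => //; apply: cvgM; [exact: cvg_cst|exact: cvg_id].
Qed.

(** On each line of constant transverse momentum the boost is a one-dimensional
    substitution, to which [lebesgue_measure_substitution] applies. *)
Lemma lebesgue3_pboost E : measurable E ->
  lebesgue3 R E =
  (\int[lebesgue3 R]_p (\1_E (pboost v p) * pboost_jac v p)%:E)%E.
Proof.
move=> mE.
have mI : measurable_fun setT
    (fun p : momentum R => (\1_E (pboost v p) * pboost_jac v p : R)%:E).
  apply/measurable_EFinP; apply: measurable_funM; last exact: measurable_pboost_jac.
  by apply: measurableT_comp; [exact: measurable_indic|exact: measurable_pboost].
rewrite lebesgue3_tonelli//; last first.
  by move=> p; rewrite lee_fin mulr_ge0// ltW// pboost_jac_gt0.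
transitivity (\int[@lebesgue2 R]_q (@lebesgue_measure R (xsection E q)))%E.
  by [].
apply: eq_integral => q _.
have J0 (s : R) : 0 <= pboost_jac v ((q, s) : momentum R).
  by rewrite ltW// pboost_jac_gt0.
have psiK : cancel (fun s : R => (pboost (- v) ((q, s) : momentum R)).2)
    (fun s : R => (pboost v ((q, s) : momentum R)).2).
  move=> s; have /(_ ((q, s) : momentum R)) := pboostK (normrN_lt1 v1).
  by rewrite opprK {2}/pboost => /(congr1 snd).
rewrite (lebesgue_measure_substitution J0 (@continuous_pboost_jac q)
  (is_derive_pboost q) (@pboost_homo q) psiK); last exact: measurable_xsection.
apply: eq_integral => s _; rewrite !indicE; congr (_%:R * _)%:E.
by rewrite mem_xsection.
Qed.

End boost_invariant_measure.

(** This is the invariance of d^3p / p^0: the Jacobian [pboost_jac] cancels p0 at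
    the boosted momentum and leaves p0 at the original one. *)
Lemma Rintegral_pboost (R : realType) (v : R) (f : momentum R -> R) :
  `|v| < 1 ->
  \int[lebesgue3 R]_p (f p / p0 p) = \int[lebesgue3 R]_p (f (pboost v p) / p0 p).
Proof.
move=> v1; have nv1 := normrN_lt1 v1.
have J0 w : forall p : momentum R, `|w| < 1 -> 0 <= pboost_jac w p.
  by move=> p w1; rewrite ltW// pboost_jac_gt0.
rewrite (@Rintegral_change_of_variables _ _ _ (lebesgue3 R) (pboost v) (pboost_jac v)).
- apply: eq_Rintegral => p _; rewrite /pboost_jac.
  by field; rewrite !gt_eqF// p0_gt0.
- by move=> p; exact: J0.
apply: (@ge0_integral_change_of_variables _ _ _ (lebesgue3 R) _ (pboost (- v)) _
  (pboost_jac (- v))).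
- exact: measurable_pboost.
- exact: measurable_pboost.
- exact: measurable_pboost_jac.
- exact: measurable_pboost_jac.
- by move=> p; exact: J0.
- by move=> p; exact: J0.
- exact: lebesgue3_pboost.
- exact: lebesgue3_pboost.
- by move=> p; have := pboostK nv1 p; rewrite opprK.
- move=> p; rewrite /pboost_jac; have := pboostK nv1 p; rewrite opprK => ->.
  by field; rewrite !gt_eqF// p0_gt0.
Qed.

(** * Integrability of functions dominated by the equilibrium *)

Section invariant_integrability.
Variable R : realType.
Implicit Types (u v theta : R) (p : momentum R) (f g : momentum R -> R).

Lemma integralT_oneDsqrV :
  (\int[@lebesgue_measure R]_s ((oneDsqr s)^-1)%:E < +oo)%E.
Proof.
rewrite (@ge0_symfun_integralT R (fun s => (oneDsqr s)^-1)); last 3 first.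
- by move=> s; rewrite invr_ge0 (le_trans ler01)// oneDsqr_ge1.
- exact: continuous_oneDsqrV.
- by move=> s /=; rewrite /oneDsqr sqrrN.
by rewrite -set_itvcy integral0y_oneDsqr -EFinM ltry.
Qed.

(** A lower bound for this product of one-variable functions is p0 ^- 6, see
    [p0_decay]; unlike a function of p0 it can be integrated by Tonelli. *)
Definition decay p : R :=
  (oneDsqr p.1.1)^-1 * (oneDsqr p.1.2)^-1 * (oneDsqr p.2)^-1.

Lemma oneDsqrV_ge0 (s : R) : 0 <= (oneDsqr s)^-1.
Proof. by rewrite invr_ge0 (le_trans ler01)// oneDsqr_ge1. Qed.

Lemma decay_ge0 p : 0 <= decay p.
Proof. by rewrite !mulr_ge0// oneDsqrV_ge0. Qed.

Lemma measurable_oneDsqrV : measurable_fun setT (fun s : R => (oneDsqr s)^-1).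
Proof. by apply: continuous_measurable_fun => x; exact: continuous_oneDsqrV. Qed.

Lemma measurable_decay : measurable_fun setT decay.
Proof.
have m12 : measurable_fun setT (fun q : R * R => (oneDsqr q.1)^-1 * (oneDsqr q.2)^-1).
  by apply: measurable_funM;
    [exact: (measurableT_comp measurable_oneDsqrV measurable_fst)
    |exact: (measurableT_comp measurable_oneDsqrV measurable_snd)].
apply: measurable_funM; last exact: (measurableT_comp measurable_oneDsqrV measurable_snd).
exact: (measurableT_comp m12 measurable_fst).
Qed.

Lemma integrable_decay : (lebesgue3 R).-integrable setT (EFin \o decay).
Proof.
apply/integrableP; split; first by apply/measurable_EFinP; exact: measurable_decay.
set I := (\int[@lebesgue_measure R]_s ((oneDsqr s)^-1)%:E)%E.
have I0 : (0 <= I)%E.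
  by apply: integral_ge0 => s _; rewrite lee_fin oneDsqrV_ge0.
have Ioo : (I < +oo)%E := integralT_oneDsqrV.
have mV : measurable_fun setT (fun s : measurableTypeR R => ((oneDsqr s)^-1)%:E).
  by apply/measurable_EFinP; exact: measurable_oneDsqrV.
have V0 (s : R) : (0 <= ((oneDsqr s)^-1)%:E)%E by rewrite lee_fin oneDsqrV_ge0.
have mVV : measurable_fun setT (fun q : measurableTypeR R * measurableTypeR R =>
    ((oneDsqr q.1)^-1 * (oneDsqr q.2)^-1)%:E).
  apply/measurable_EFinP.
  by apply: measurable_funM;
    [exact: (measurableT_comp measurable_oneDsqrV measurable_fst)
    |exact: (measurableT_comp measurable_oneDsqrV measurable_snd)].
have VV0 (q : R * R) : (0 <= ((oneDsqr q.1)^-1 * (oneDsqr q.2)^-1)%:E)%E.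
  by rewrite lee_fin mulr_ge0// oneDsqrV_ge0.
under eq_integral do rewrite /= ger0_norm ?decay_ge0//.
rewrite lebesgue3_tonelli; last 2 first.
- by apply/measurable_EFinP; exact: measurable_decay.
- by move=> p; rewrite lee_fin decay_ge0.
have e2 : (\int[@lebesgue2 R]_q ((oneDsqr q.1)^-1 * (oneDsqr q.2)^-1)%:E = I * I)%E.
  transitivity (\int[@lebesgue_measure R]_x (((oneDsqr x)^-1)%:E * I))%E.
    rewrite [LHS](@fubini_tonelli1 _ _ _ _ R (@lebesgue_measure R)
      (@lebesgue_measure R) _ mVV VV0).
    by apply: eq_integral => x _; rewrite -ge0_integralZl.
  by rewrite ge0_integralZr.
have -> : (\int[@lebesgue2 R]_q \int[@lebesgue_measure R]_s (decay (q, s))%:E =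
    \int[@lebesgue2 R]_q (((oneDsqr q.1)^-1 * (oneDsqr q.2)^-1)%:E * I))%E.
  by apply: eq_integral => q _; rewrite -ge0_integralZl.
have IIoo : (I * I < +oo)%E by rewrite lte_mul_pinfty// ge0_fin_numE.
by rewrite ge0_integralZr// e2 lte_mul_pinfty// ?mule_ge0// ge0_fin_numE// mule_ge0.
Qed.

(** As p0 >= 1, this class is closed under products and sums without keeping
    track of degrees. *)
Definition poly_bounded f := exists2 C : R, 0 <= C &
  exists n, forall p, `|f p| <= C * p0 p ^+ n.

Lemma poly_bounded_cst (c : R) : poly_bounded (fun=> c).
Proof. by exists `|c| => //; exists 0%N => p; rewrite expr0 mulr1. Qed.

Lemma poly_bounded_le f g :
  (forall p, `|f p| <= `|g p|) -> poly_bounded g -> poly_bounded f.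
Proof.
by move=> fg [C C0 [n H]]; exists C => //; exists n => p; exact: le_trans (H p).
Qed.

Lemma poly_bounded_p0 : poly_bounded (@p0 R).
Proof.
exists 1 => //; exists 1%N => p.
by rewrite expr1 mul1r ger0_norm// ltW// p0_gt0.
Qed.

Lemma poly_boundedM f g : poly_bounded f -> poly_bounded g ->
  poly_bounded (fun p => f p * g p).
Proof.
move=> [C C0 [n fC]] [D D0 [m gD]]; exists (C * D); first exact: mulr_ge0.
exists (n + m)%N => p; rewrite normrM exprD mulrACA.
exact: ler_pM.
Qed.

Lemma poly_boundedD f g : poly_bounded f -> poly_bounded g ->
  poly_bounded (fun p => f p + g p).
Proof.
move=> [C C0 [n fC]] [D D0 [m gD]]; exists (C + D); first exact: addr_ge0.
exists (n + m)%N => p; rewrite (le_trans (ler_normD _ _))// mulrDl lerD//.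
  rewrite (le_trans (fC p))// ler_wpM2l// ler_weXn2l ?p0_ge1 ?leq_addr//.
rewrite (le_trans (gD p))// ler_wpM2l// ler_weXn2l ?p0_ge1 ?leq_addl//.
Qed.

Lemma poly_boundedX f n : poly_bounded f -> poly_bounded (fun p => f p ^+ n).
Proof.
move=> hf; elim: n => [|n IH].
  exact: (poly_bounded_cst 1).
by apply: poly_bounded_le (poly_boundedM hf IH) => p; rewrite exprS.
Qed.

Lemma poly_bounded_horner (P : {poly R}) f :
  poly_bounded f -> poly_bounded (fun p => P.[f p]).
Proof.
move=> hf; elim/poly_ind: P => [|P c IH].
  by apply: poly_bounded_le (poly_bounded_cst 0) => p; rewrite horner0.
apply: poly_bounded_le (poly_boundedD (poly_boundedM IH hf) (poly_bounded_cst c)).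
by move=> p; rewrite !hornerE.
Qed.

Lemma poly_bounded_p3 : poly_bounded (@p3 R).
Proof.
apply: poly_bounded_le poly_bounded_p0 => p.
by rewrite [X in _ <= X]ger0_norm ?normr_p3_le// ltW// p0_gt0.
Qed.

Lemma poly_bounded_energy u : poly_bounded (energy u).
Proof.
have := poly_boundedD (poly_boundedM (poly_bounded_cst (U0 u)) poly_bounded_p0)
  (poly_boundedM (poly_bounded_cst (- U3 u)) poly_bounded_p3).
by apply: poly_bounded_le => p; rewrite /energy mulNr.
Qed.

(** The interval E^2 - (U^0 p^3 - U^3 p^0)^2 = (p^0)^2 - (p^3)^2 is Lorentz
    invariant. *)
Lemma energy_sqrB u p : `|u| < 1 ->
  energy u p ^+ 2 - (U0 u * p3 p - U3 u * p0 p) ^+ 2 =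
  1 + p.1.1 ^+ 2 + p.1.2 ^+ 2.
Proof.
move=> u1; have g2 := lorentz_sqr u1; have e := p0_sqr p.
rewrite (_ : 1 + _ + _ = p0 p ^+ 2 - p.2 ^+ 2); last by rewrite e; ring.
by rewrite /energy /U3 /U0 /p3 -[RHS]mul1r -g2; ring.
Qed.

Lemma normr_ycos_le1 u p : `|u| < 1 -> `|ycos u p| <= 1.
Proof.
move=> u1; have := energy_sqrB p u1; set w := _ - _ * p0 p => e.
have w2 : w ^+ 2 <= energy u p ^+ 2 - 1.
  rewrite -subr_ge0 (_ : _ - _ = p.1.1 ^+ 2 + p.1.2 ^+ 2) ?addr_ge0 ?sqr_ge0//.
  by rewrite addrAC e; ring.
rewrite /ycos -/w normrM normfV (ger0_norm (sqrtr_ge0 _)).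
have ws : `|w| <= Num.sqrt (energy u p ^+ 2 - 1) by rewrite -sqrtr_sqr ler_wsqrtr.
have [s0|s0] := eqVneq (Num.sqrt (energy u p ^+ 2 - 1)) 0.
  by rewrite s0 invr0 mul0r.
by rewrite mulrC ler_pdivrMr ?mul1r// lt_neqAle eq_sym s0 sqrtr_ge0.
Qed.

(** Since |u| < 1, the energy in the moving frame is comparable to p^0, so decay
    in E is decay in p^0. *)
Lemma energy_ge u p : `|u| < 1 -> U0 u * (1 - `|u|) * p0 p <= energy u p.
Proof.
move=> u1; have g0 := lorentz_gt0 u1.
rewrite /energy /U3 -!mulrA -mulrBr ler_wpM2l// ?(ltW g0)//.
rewrite mulrBl mul1r lerB// (le_trans (ler_norm _))// normrM ler_wpM2l//.
exact: normr_p3_le.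
Qed.

(** From the Taylor bound y ^+ n <= n`! exp y at y = l x. *)
Lemma expR_decay (l : R) n (x : R) : 0 < l -> 0 <= x ->
  x ^+ n.+1 * expR (- (l * x)) <= n.+1`!%:R / l ^+ n.+1.
Proof.
move=> l0 x0; rewrite expRN ler_pdivrMr ?expR_gt0// mulrAC.
rewrite ler_pdivlMr ?exprn_gt0// -exprMn [x * l]mulrC.
rewrite -ler_pdivrMl ?ltr0n ?fact_gt0// [X in X <= _]mulrC.
apply: le_trans (expR_ge1Dxn n (mulr_ge0 (ltW l0) x0)).
by rewrite lerDr.
Qed.

Lemma p0_decay p : 1 <= p0 p ^+ 6 * decay p.
Proof.
have h0 (s : R) : 0 < oneDsqr s by rewrite (lt_le_trans ltr01)// oneDsqr_ge1.
have h (s : R) : oneDsqr s <= p0 p ^+ 2 -> 1 <= p0 p ^+ 2 * (oneDsqr s)^-1.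
  by move=> H; rewrite ler_pdivlMr ?mul1r.
have a := sqr_ge0 p.1.1; have b := sqr_ge0 p.1.2; have c := sqr_ge0 p.2.
rewrite (_ : _ * _ = (p0 p ^+ 2 * (oneDsqr p.1.1)^-1) *
  (p0 p ^+ 2 * (oneDsqr p.1.2)^-1) * (p0 p ^+ 2 * (oneDsqr p.2)^-1)); last first.
  by rewrite /decay; ring.
by apply: mulr_ege1; [apply: mulr_ege1|]; apply: h; rewrite p0_sqr /oneDsqr; lra.
Qed.

Lemma measurable_energy u : measurable_fun setT (energy u).
Proof.
apply: measurable_funB.
  by apply: measurable_funM; [exact: measurable_cst|exact: measurable_p0].
by apply: measurable_funM; [exact: measurable_cst|exact: measurable_p3].
Qed.

(** The exponential absorbs both the power of p0 bounding f and the p0 ^+ 6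
    needed to compare with [decay]. *)
Lemma integrable_poly_bounded u theta f : `|u| < 1 -> 0 < theta ->
  measurable_fun setT f -> poly_bounded f ->
  (lebesgue3 R).-integrable setT
    (EFin \o (fun p => f p * expR (- energy u p / theta))).
Proof.
move=> u1 th0 mf [C C0 [n fC]].
pose l := U0 u * (1 - `|u|) / theta.
have l0 : 0 < l by rewrite divr_gt0// mulr_gt0 ?subr_gt0// lorentz_gt0.
pose D := (n + 5).+1`!%:R / l ^+ (n + 5).+1.
apply: (@le_integrable _ _ _ (lebesgue3 R) setT measurableT _
  (fun p => (C * D)%:E * (decay p)%:E)%E) => //.
- apply/measurable_EFinP; apply: measurable_funM => //.
  apply: (measurableT_comp (@measurable_expR R)).
  apply: measurable_funM; last exact: measurable_cst.
  by apply: measurableT_comp => //; exact: measurable_energy.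
- move=> p _ /=; rewrite lee_fin.
  have D0 : 0 <= D by rewrite divr_ge0// exprn_ge0// ltW.
  rewrite [X in _ <= X]ger0_norm; last first.
    by apply: mulr_ge0 (decay_ge0 p); exact: mulr_ge0.
  rewrite normrM (ger0_norm (expR_ge0 _)) -mulrA.
  have q0 := p0_gt0 p.
  have expl : expR (- energy u p / theta) <= expR (- (l * p0 p)).
    rewrite ler_expR mulNr lerN2 /l mulrAC ler_pM2r ?invr_gt0//.
    exact: energy_ge.
  apply: (le_trans (ler_pM (normr_ge0 _) (expR_ge0 _) (fC p) expl)).
  rewrite -mulrA ler_wpM2l//.
  apply: (@le_trans _ _ (p0 p ^+ n * expR (- (l * p0 p)) * (p0 p ^+ 6 * decay p))).
    by rewrite ler_peMr ?p0_decay// mulr_ge0 ?expR_ge0// exprn_ge0// ltW.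
  rewrite mulrA ler_wpM2r ?decay_ge0// mulrAC -exprD addnS.
  by apply: expR_decay => //; exact: ltW.
- exact: (integrableZl measurableT (C * D) integrable_decay).
Qed.

End invariant_integrability.

(** * Moment matrices and source term of a boosted state *)

Section moment_matrices.
Variables (R : realType) (M : nat).
Hypothesis M_ge1 : (1 <= M)%N.
Implicit Types (u v theta : R) (W : state R M) (p : momentum R).

Lemma inner_pboost v u theta (f g : momentum R -> R) :
  `|u| < 1 -> `|v| < 1 ->
  inner (vadd v u) theta f g = inner u theta (f \o pboost v) (g \o pboost v).
Proof.
move=> u1 v1; rewrite /inner (Rintegral_pboost _ v1).
by apply: eq_Rintegral => p _ /=; rewrite equilibrium_pboost.
Qed.

Lemma nmom_gt1 : (1 < nmom M)%N.
Proof.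
by rewrite /nmom geq_half_double; nia.
Qed.

Definition u_index : 'I_(nmom M) := Ordinal nmom_gt1.

Lemma componentE W (i : 'I_(nmom M)) : component W i = W i 0.
Proof.
rewrite /component insubT => [|lti]; first exact: ltn_ord.
by congr (W _ _); exact: val_inj.
Qed.

Lemma WuE W : Wu W = W u_index 0.
Proof. exact: (componentE W u_index). Qed.

Lemma component_boost_state v W k : k != 1%N ->
  component (boost_state v W) k = component W k.
Proof.
rewrite /component => k1; case: insubP => [i _ ik|//].
by rewrite mxE ik (negbTE k1).
Qed.

Lemma Wu_boost_state v W : Wu (boost_state v W) = vadd v (Wu W).
Proof. by rewrite [LHS]WuE mxE eqxx. Qed.

Lemma Wtheta_boost_state v W : Wtheta (boost_state v W) = Wtheta W.
Proof. exact: component_boost_state. Qed.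

Lemma Wn_boost_state v W : Wn (boost_state v W) = Wn W.
Proof. exact: component_boost_state. Qed.

Lemma eqcoefs_boost_state v W : eqcoefs (boost_state v W) = eqcoefs W.
Proof.
by rewrite /eqcoefs Wn_boost_state Wtheta_boost_state.
Qed.

Lemma kl_of_u_index : kl_of u_index = (1, 0)%N.
Proof.
change (nth (0, 0)%N (indices M) 1 = (1, 0)%N).
by rewrite -(prednK M_ge1).
Qed.

(** The coefficients involve only the scalar components: for M >= 2 the entry that
    holds u has (k, l) = (1, 0), and the coefficient for this pair comes from Pi. *)
Lemma coefs_boost_state v W : coefs (boost_state v W) = coefs W.
Proof.
rewrite /coefs; case: ifP => _; first exact: eqcoefs_boost_state.
rewrite Wn_boost_state Wtheta_boost_state.
rewrite /WPi /Wf !component_boost_state//.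
apply/colP => i; rewrite !mxE.
have [->|i1] := eqVneq i u_index; first by rewrite kl_of_u_index.
by rewrite ifF//; apply: contraNF i1 => /eqP i1; apply/eqP/val_inj.
Qed.

Lemma basis_pboost v u theta (i : 'I_(nmom M)) p : `|u| < 1 -> `|v| < 1 ->
  basis (vadd v u) theta i (pboost v p) = basis u theta i p.
Proof. exact: Ptilde_pboost. Qed.

Lemma moment_mx_pboost v (a : momentum R -> R) W :
  `|Wu W| < 1 -> `|v| < 1 ->
  moment_mx a (boost_state v W) = moment_mx (a \o pboost v) W.
Proof.
move=> u1 v1; apply/matrixP => i j; rewrite !mxE Wu_boost_state Wtheta_boost_state.
rewrite [LHS](inner_pboost _ _ _ u1 v1).
apply: (f_equal2 (inner (Wu W) (Wtheta W))); apply/funext => p /=.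
  by rewrite basis_pboost.
by rewrite basis_pboost.
Qed.

(** The quotient of a basis function by the equilibrium. *)
Definition Ptilde_ratio u theta k l p : R :=
  (orthopoly l theta^-1 k).[energy u p]
  * Num.sqrt (energy u p ^+ 2 - 1) ^+ l * (legendre R l).[ycos u p].

Lemma PtildeE u theta k l p :
  Ptilde u theta k l p = equilibrium u theta p * Ptilde_ratio u theta k l p.
Proof. by rewrite /Ptilde /Ptilde_ratio !mulrA. Qed.

Lemma poly_bounded_Ptilde_ratio u theta k l :
  `|u| < 1 -> poly_bounded (Ptilde_ratio u theta k l).
Proof.
move=> u1; apply: poly_boundedM; first apply: poly_boundedM.
- by apply: poly_bounded_horner; exact: poly_bounded_energy.
- apply: poly_boundedX; apply: poly_bounded_le (poly_bounded_energy u) => p.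
  by rewrite ger0_norm ?sqrtr_ge0// -sqrtr_sqr ler_wsqrtr// gerBl.
- apply: poly_bounded_horner; apply: poly_bounded_le (poly_bounded_cst 1) => p.
  by rewrite normr1 normr_ycos_le1.
Qed.

Lemma measurable_horner (P : {poly R}) (f : momentum R -> R) :
  measurable_fun setT f -> measurable_fun setT (fun p => P.[f p]).
Proof. by apply: measurableT_comp; exact: measurable_poly. Qed.

Lemma measurable_Ptilde_ratio u theta k l :
  measurable_fun setT (Ptilde_ratio u theta k l).
Proof.
have mE := measurable_energy u.
have mS : measurable_fun setT (fun p : momentum R => Num.sqrt (energy u p ^+ 2 - 1)).
  apply: (measurableT_comp (@measurable_sqrt R)).
  by apply: measurable_funB; [exact: measurable_funX|exact: measurable_cst].
apply: measurable_funM; first apply: measurable_funM.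
- exact: measurable_horner.
- exact: measurable_funX.
- apply: measurable_horner; apply: measurable_funM.
    exact: (measurableT_comp (@measurable_invr R) mS).
  by apply: measurable_funB; apply: measurable_funM; first [exact: measurable_cst
    |exact: measurable_p0|exact: measurable_p3].
Qed.

(** The three equilibrium factors combine into a single one, which supplies the
    decay. *)
Lemma integrable_moment u theta (a : momentum R -> R) (i j : 'I_(nmom M)) :
  `|u| < 1 -> 0 < theta -> measurable_fun setT a -> poly_bounded a ->
  (lebesgue3 R).-integrable setT (EFin \o (fun p =>
     (equilibrium u theta p)^-1 * (a p * basis u theta i p) * basis u theta j p / p0 p)).
Proof.
move=> u1 th0 ma ba.
rewrite /basis; set k := (kl_of i).1; set l := (kl_of i).2.
set k' := (kl_of j).1; set l' := (kl_of j).2.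
pose K := theta^-1 / (4 * pi * besselK 2 theta^-1).
pose f p := K *
  (a p * Ptilde_ratio u theta k l p * Ptilde_ratio u theta k' l' p * (p0 p)^-1).
rewrite (_ : (fun p => _) = fun p => f p * expR (- energy u p / theta)); last first.
  apply/funext => p; rewrite !PtildeE /f.
  have -> : equilibrium u theta p = K * expR (- energy u p / theta) by [].
  (* If K2 vanished, the equilibrium would be 0, and so would both sides. *)
  have [->|K0] := eqVneq K 0; first by rewrite !mul0r invr0 !mul0r.
  by field; rewrite K0 !gt_eqF// ?p0_gt0 ?expR_gt0.
apply: integrable_poly_bounded => //.
  apply: measurable_funM; first exact: measurable_cst.
  apply: measurable_funM; last first.
    exact: (measurableT_comp (@measurable_invr R) (@measurable_p0 R)).
  by apply: measurable_funM; [apply: measurable_funM => //|]; exact: measurable_Ptilde_ratio.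
apply: poly_boundedM; first exact: poly_bounded_cst.
apply: poly_boundedM; last first.
  apply: poly_bounded_le (poly_bounded_cst 1) => p.
  by rewrite normr1 normfV ger0_norm ?(ltW (p0_gt0 p))// invf_le1 ?p0_gt0// p0_ge1.
by apply: poly_boundedM; [apply: poly_boundedM => //|]; exact: poly_bounded_Ptilde_ratio.
Qed.

Lemma moment_mx_linear (a b : momentum R -> R) (c d : R) W :
  `|Wu W| < 1 -> 0 < Wtheta W ->
  measurable_fun setT a -> poly_bounded a ->
  measurable_fun setT b -> poly_bounded b ->
  moment_mx (fun p => c * (a p - d * b p)) W =
  c *: (moment_mx a W - d *: moment_mx b W).
Proof.
move=> u1 th0 ma ba mb bb; apply/matrixP => i j; rewrite !mxE /inner.
have ia := integrable_moment i j u1 th0 ma ba.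
have ib := integrable_moment i j u1 th0 mb bb.
have idb := integrableZl measurableT d ib.
rewrite -(RintegralZl d measurableT ib) -(RintegralB measurableT ia idb).
rewrite -(RintegralZl c measurableT); last exact: (integrableB measurableT ia idb).
by apply: eq_Rintegral => p _; ring.
Qed.

Lemma moment_mx_p0_boost v W : `|v| < 1 -> `|Wu W| < 1 -> 0 < Wtheta W ->
  moment_mx (@p0 R) (boost_state v W) =
  lorentz v *: (moment_mx (@p0 R) W - v *: moment_mx (@p3 R) W).
Proof.
move=> v1 u1 th0; rewrite moment_mx_pboost//.
rewrite -moment_mx_linear//; first last.
- exact: poly_bounded_p3.
- exact: measurable_p3.
- exact: poly_bounded_p0.
- exact: measurable_p0.
suff -> : @p0 R \o pboost v = (fun p => lorentz v * (p0 p - v * p3 p)) by [].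
by apply/funext => p /=; rewrite p0_pboost.
Qed.

Lemma moment_mx_p3_boost v W : `|v| < 1 -> `|Wu W| < 1 -> 0 < Wtheta W ->
  moment_mx (@p3 R) (boost_state v W) =
  lorentz v *: (moment_mx (@p3 R) W - v *: moment_mx (@p0 R) W).
Proof.
move=> v1 u1 th0; rewrite moment_mx_pboost//.
rewrite -moment_mx_linear//; first last.
- exact: poly_bounded_p0.
- exact: measurable_p0.
- exact: poly_bounded_p3.
- exact: measurable_p3.
Qed.

Lemma source_boost_state tau v W : `|v| < 1 -> `|Wu W| < 1 ->
  source tau (boost_state v W) = source tau W.
Proof.
move=> v1 u1; rewrite /source coefs_boost_state eqcoefs_boost_state.
rewrite Wn_boost_state Wtheta_boost_state Wu_boost_state moment_mx_pboost//.
suff -> : energy (vadd v (Wu W)) \o pboost v = energy (Wu W) by [].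
by apply/funext => p /=; rewrite energy_pboost.
Qed.

End moment_matrices.

(** * Derivatives of the distribution function at a boosted state *)

(** Directional derivatives depend only on the restriction to the line, whether
    or not they exist. *)
Lemma derive_eq_line (R : numFieldType) (U V W : normedModType R)
    (f : U -> W) (g : V -> W) (a x : U) (b y : V) :
  (forall h : R, f (h *: x + a) = g (h *: y + b)) -> 'D_x f a = 'D_y g b.
Proof.
move=> fg; rewrite /derive.
have fgab : f a = g b by have := fg 0; rewrite !scale0r !add0r.
suff -> : (fun h => h^-1 *: ((f \o shift a) (h *: x) - f a)) =
          (fun h => h^-1 *: ((g \o shift b) (h *: y) - g b)) by [].
by apply/funext => h /=; rewrite fg fgab.
Qed.

(** No derivability of f or g is assumed: as phi is locally a diffeomorphism, f is
    derivable at phi a exactly when g is derivable at a, and a derivative that does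
    not exist has the value 0. *)
Lemma derive_comp_diffeo (R : realType) (phi psi f g : R -> R) (a : R) :
  derivable phi a 1 -> derivable psi (phi a) 1 -> psi (phi a) = a ->
  (\forall x \near a, g x = f (phi x)) ->
  (\forall y \near phi a, f y = g (psi y)) ->
  'D_1 g a = phi^`()%classic a * 'D_1 f (phi a).
Proof.
move=> dphi dpsi psiK gf fg.
have [df|ndf] := pselect (derivable f (phi a) 1).
  rewrite (near_eq_derive _ gf) -!derive1E.
  by rewrite (derive1_comp dphi df) mulrC.
have ndg : ~ derivable g a 1.
  move=> dg; apply: ndf; apply: (@near_eq_derivable _ _ _ (g \o psi)).
    by near=> y; rewrite /= (near fg y).
  apply/derivable1_diffP/differentiable_comp; first exact/derivable1_diffP.
  by rewrite psiK; exact/derivable1_diffP.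
have -> : 'D_1 g a = 0 by exact: dvgP ndg.
have -> : 'D_1 f (phi a) = 0 by exact: dvgP ndf.
by rewrite mulr0.
Unshelve. all: by end_near. Qed.

Definition vadd_jac (R : realType) (v u : R) : R :=
  (1 - v ^+ 2) / (1 - u * v) ^+ 2.

Section coefficient_matrices.
Variables (R : realType) (M : nat).
Hypothesis M_ge1 : (1 <= M)%N.
Implicit Types (u v theta : R) (W : state R M) (p : momentum R).

Local Notation iu := (u_index M_ge1).

Lemma is_derive_vadd v u : `|u| < 1 -> `|v| < 1 ->
  is_derive u 1 (vadd v) (vadd_jac v u).
Proof.
move=> u1 v1; have d0 : 1 - u * v != 0 by rewrite gt_eqF// oneBM_gt0.
have dn : is_derive u 1 (fun x : R => x - v) 1.
  by apply: is_derive_eq; rewrite subr0.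
have dd : is_derive u 1 (fun x : R => 1 - x * v) (- v).
  by apply: is_derive_eq; rewrite /GRing.scale/=; ring.
have dV : is_derive u 1 (fun x : R => (1 - x * v)^-1) (- (1 - u * v) ^- 2 *: - v).
  have [d1 d2] := dd; apply: DeriveDef; first exact: derivableV.
  by rewrite deriveV// d2.
have := is_deriveM dn dV => H; apply: (is_derive_eq H).
by rewrite /vadd_jac /GRing.scale/=; field.
Qed.

Lemma vadd_jac_gt0 v u : `|u| < 1 -> `|v| < 1 -> 0 < vadd_jac v u.
Proof. by move=> u1 v1; rewrite divr_gt0 ?exprn_gt0 ?oneBM_gt0 ?oneBsqr_gt0. Qed.

Lemma distribution_fun_pboost v W p : `|Wu W| < 1 -> `|v| < 1 ->
  distribution_fun (boost_state v W) (pboost v p) = distribution_fun W p.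
Proof.
move=> u1 v1; rewrite /distribution_fun coefs_boost_state//; apply: eq_bigr => i _.
by rewrite Wu_boost_state// Wtheta_boost_state basis_pboost.
Qed.

Local Notation delta j := (delta_mx j 0 : 'cV[R]_(nmom M)).

Lemma boost_state_shift v W (j : 'I_(nmom M)) (h : R) : j != iu ->
  boost_state v (h *: delta j + W) = h *: delta j + boost_state v W.
Proof.
move=> ju; apply/colP => i; rewrite !mxE.
case: ifPn => // i1; rewrite !(WuE M_ge1) !mxE.
have -> : i = iu by apply/val_inj/eqP.
by rewrite (eq_sym iu) (negbTE ju) /= mulr0 !add0r.
Qed.

Lemma boost_state_shift_u v W (s : R) :
  boost_state v ((s - Wu W) *: delta iu + W) =
  (vadd v s - vadd v (Wu W)) *: delta iu + boost_state v W.
Proof.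
apply/colP => i; rewrite !mxE.
have [iE|i1] := eqVneq (val i) 1%N.
  have -> : i = iu by apply/val_inj.
  rewrite eqxx/= !mulr1 -/(vadd _ _) (WuE M_ge1) !mxE eqxx mulr1 -(WuE M_ge1).
  by rewrite !subrK.
suff /negbTE -> : i != iu by rewrite /= !mulr0 !add0r.
by apply: contraNneq i1 => ->.
Qed.

Lemma Wu_shift W (j : 'I_(nmom M)) (h : R) :
  Wu (h *: delta j + W) = h * (iu == j)%:R + Wu W.
Proof. by rewrite !(WuE M_ge1) !mxE andbT. Qed.

(** A displacement of the state in a direction other than u commutes with the
    boost, so the difference quotients agree. *)
Lemma partialF_pboost v W j p : j != iu -> `|Wu W| < 1 -> `|v| < 1 ->
  partialF (boost_state v W) j (pboost v p) = partialF W j p.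
Proof.
move=> ju u1 v1; apply: derive_eq_line => h.
rewrite -boost_state_shift// distribution_fun_pboost// Wu_shift.
by rewrite (eq_sym iu) (negbTE ju) mulr0 add0r.
Qed.

Lemma partialF_lineE W p :
  partialF W iu p =
  'D_1 (fun s : R => distribution_fun ((s - Wu W) *: delta iu + W) p) (Wu W).
Proof.
by apply: derive_eq_line => h; rewrite [h *: 1]mulr1 addrK.
Qed.

Lemma near_norm_lt1 u : `|u| < 1 -> \forall x \near u, `|x| < 1.
Proof.
move=> u1; have uu : x @[x --> u] --> u by [].
exact: (cvgr_norm_lt u uu 1 u1).
Qed.

(** In the direction u the boost acts on the line of states by velocity addition,
    whose inverse is velocity addition of -v. *)
Lemma partialF_pboost_u v W p : `|Wu W| < 1 -> `|v| < 1 ->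
  partialF W iu p =
  vadd_jac v (Wu W) * partialF (boost_state v W) iu (pboost v p).
Proof.
move=> u1 v1; rewrite !partialF_lineE Wu_boost_state//.
have [dphi dphiE] := is_derive_vadd u1 v1.
have w1 := vadd_lt1 u1 v1.
have [dpsi _] := is_derive_vadd w1 (normrN_lt1 v1).
rewrite (derive_comp_diffeo dphi dpsi (vaddK u1 v1)
  (f := fun s : R => distribution_fun
    ((s - vadd v (Wu W)) *: delta iu + boost_state v W) (pboost v p))).
- by rewrite derive1E dphiE.
- have := near_norm_lt1 u1; apply: filterS => s s1.
  rewrite -boost_state_shift_u distribution_fun_pboost//.
  by rewrite Wu_shift eqxx mulr1 subrK.
- have := near_norm_lt1 w1; apply: filterS => s s1.
  rewrite -[in RHS](distribution_fun_pboost _ _ v1); last first.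
    by rewrite Wu_shift eqxx mulr1 subrK vadd_lt1// normrN.
  rewrite boost_state_shift_u.
  by have := vaddK s1 (normrN_lt1 v1); rewrite opprK => ->.
Qed.

(** The diagonal of the Jacobian matrix of [boost_state v]. *)
Definition jac_row v u : 'rV[R]_(nmom M) :=
  \row_j if j == iu then vadd_jac v u else 1.

(** The chain rule for the dependence of F on the state, seen through the
    invariant inner product. *)
Lemma Dmx_boost_state v W : `|Wu W| < 1 -> `|v| < 1 ->
  Dmx (boost_state v W) *m diag_mx (jac_row v (Wu W)) = Dmx W.
Proof.
move=> u1 v1; apply/matrixP => i j; rewrite mul_mx_diag !mxE.
rewrite Wu_boost_state// Wtheta_boost_state [X in X * _](inner_pboost _ _ _ u1 v1).
have -> : basis (vadd v (Wu W)) (Wtheta W) i \o pboost v = basis (Wu W) (Wtheta W) i.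
  by apply/funext => p /=; rewrite basis_pboost.
case: eqVneq => [->|ju]; last first.
  suff -> : partialF (boost_state v W) j \o pboost v = partialF W j by rewrite mulr1.
  by apply/funext => p /=; rewrite partialF_pboost.
rewrite mulrC /inner -RintegralZ_nonmeasurable ?vadd_jac_gt0//.
apply: eq_Rintegral => p _ /=.
by rewrite (partialF_pboost_u p u1 v1); ring.
Qed.

End coefficient_matrices.

(** * Derivatives of a boosted field *)

Section boosted_field.
Variables (R : realType) (M : nat) (v : R) (W : R * R -> 'cV[R]_(nmom M)).
Hypotheses (M_ge1 : (1 <= M)%N) (v1 : `|v| < 1).
Variable z : R * R.
Hypotheses (dW : differentiable W z) (W_adm : admissible (W z)).

Local Notation iu := (u_index M_ge1).
Local Notation J := (diag_mx (jac_row M_ge1 v (Wu (W z)))).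

Lemma boost_line (h : R) (e y : R * R) :
  boost v (h *: e + y) = h *: boost v e + boost v y.
Proof.
rewrite /boost; congr (_, _); rewrite /= /GRing.scale /=; ring.
Qed.

Lemma differentiable_entry i : differentiable (fun y => W y i 0) z.
Proof.
exact: (@differentiable_comp _ _ _ _ W (fun N : 'cV[R]_(nmom M) => N i 0) z dW
  (differentiable_coord _ _ _)).
Qed.

Lemma derive_entry (e : R * R) i : 'D_e (fun y => W y i 0) z = 'D_e W z i 0.
Proof.
have dWe : derivable W z e by exact: diff_derivable.
by rewrite (derive_mx dWe) mxE.
Qed.

Lemma differentiable_vadd_entry : differentiable (fun y => vadd v (W y iu 0)) z.
Proof.
have [_ u1 _] := W_adm; rewrite (WuE M_ge1) in u1.
have [dphi _] := is_derive_vadd u1 v1.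
apply: (@differentiable_comp _ _ _ _ (fun y => W y iu 0) (vadd v)).
  exact: differentiable_entry.
exact/derivable1_diffP.
Qed.

Lemma derive_vadd_entry (e : R * R) :
  'D_e (fun y => vadd v (W y iu 0)) z = vadd_jac v (Wu (W z)) * 'D_e W z iu 0.
Proof.
have [_ u1 _] := W_adm; rewrite (WuE M_ge1) in u1 *.
have [dphi dphiE] := is_derive_vadd u1 v1.
rewrite deriveE; last exact: differentiable_vadd_entry.
rewrite (@diff_comp _ _ _ _ (fun y => W y iu 0) (vadd v)); last 2 first.
- exact: differentiable_entry.
- exact/derivable1_diffP.
rewrite /= deriv1E// derive1E dphiE -deriveE; last exact: differentiable_entry.
by rewrite derive_entry mulrC.
Qed.

Lemma boost_state_fieldE i y :
  boost_state v (W y) i 0 = if i == iu then vadd v (W y iu 0) else W y i 0.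
Proof.
rewrite mxE; case: eqVneq => [iE|i1].
  by rewrite (_ : i = iu) ?eqxx -?(WuE M_ge1)//; apply/val_inj.
by rewrite ifF//; apply: contraNF i1 => /eqP ->.
Qed.

Lemma derive_boost_state (e : R * R) :
  'D_e (fun y => boost_state v (W y)) z = J *m 'D_e W z.
Proof.
have dG : derivable (fun y => boost_state v (W y)) z e.
  apply/derivable_mxP => i j; rewrite ord1.
  under eq_fun do rewrite boost_state_fieldE.
  case: (i == iu); apply: diff_derivable; first exact: differentiable_vadd_entry.
  exact: differentiable_entry.
rewrite (derive_mx dG); apply/colP => i; rewrite mul_diag_mx !mxE.
under eq_fun do rewrite boost_state_fieldE.
case: eqVneq => [->|_]; first by rewrite derive_vadd_entry.
by rewrite mul1r derive_entry.
Qed.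

End boosted_field.

(** * Covariance of the system *)

(** The mixed terms A *m t and B *m s cancel; the others carry the factor
    g ^+ 2 * (1 - v ^+ 2). *)
Lemma flux_combination (F : comPzRingType) (m n : nat) (A B : 'M[F]_(m, n))
    (s t : 'cV[F]_n) (v g : F) :
  g ^+ 2 * (1 - v ^+ 2) = 1 ->
  (g *: (A - v *: B)) *m (g *: s + (g * v) *: t) +
  (g *: (B - v *: A)) *m ((g * v) *: s + g *: t) = A *m s + B *m t.
Proof.
move=> g1.
rewrite !(mulmxDr, mulmxBl, scalerBr, mulmxDl, mulNmx, =^~ scalemxAl, =^~ scalemxAr).
move: (A *m s) (A *m t) (B *m s) (B *m t) => a b c d; apply/colP => i.
rewrite !mxE; move: (a _ _) (b _ _) (c _ _) (d _ _) => {a b c d} a b c d.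
by rewrite -[RHS]mul1r -g1; ring.
Qed.

Section boosted_system.
Variables (R : realType) (M : nat) (v : R) (W : R * R -> 'cV[R]_(nmom M)).
Hypotheses (M_ge1 : (1 <= M)%N) (v1 : `|v| < 1).
Variable z : R * R.
Hypotheses (dW : differentiable W z) (W_adm : admissible (W z)).

Local Notation J := (diag_mx (jac_row M_ge1 v (Wu (W z)))).
Local Notation dt := ('D_((1, 0) : R * R) W z).
Local Notation dx := ('D_((0, 1) : R * R) W z).

Lemma derive_boost_field (e : R * R) :
  'D_e (boost_field v W) (boost v z) =
  J *m ((boost (- v) e).1 *: dt + (boost (- v) e).2 *: dx).
Proof.
have -> : 'D_e (boost_field v W) (boost v z) =
    'D_(boost (- v) e) (fun y => boost_state v (W y)) z.
  by apply: derive_eq_line => h; rewrite /boost_field boost_line boostK.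
rewrite (derive_boost_state M_ge1 v1 dW W_adm); congr (_ *m _).
case: (boost (- v) e) => a b /=.
rewrite !deriveE// -!linearZ -linearD; congr ('d W z _).
by congr (_, _); [change (a = a * 1 + b * 0)|change (b = a * 0 + b * 1)]; ring.
Qed.

(** The Jacobian produced by the derivatives of the field is absorbed by the matrix
    D, after which [flux_combination] applies. *)
Lemma boosted_flux :
  B0 (boost_field v W (boost v z)) *m 'D_((1, 0) : R * R) (boost_field v W) (boost v z)
  + B3 (boost_field v W (boost v z)) *m 'D_((0, 1) : R * R) (boost_field v W) (boost v z)
  = B0 (W z) *m dt + B3 (W z) *m dx.
Proof.
have [_ u1 th0] := W_adm.
have DJ (A : 'M[R]_(nmom M)) (c d : R) :
    A *m Dmx (boost_state v (W z)) *m (J *m (c *: dt + d *: dx)) =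
    A *m (c *: (Dmx (W z) *m dt) + d *: (Dmx (W z) *m dx)).
  by rewrite -(Dmx_boost_state M_ge1 u1 v1) !scalemxAr -mulmxDr !mulmxA.
rewrite !derive_boost_field /boost_field boostK// /B0 /B3 !DJ.
rewrite moment_mx_p0_boost// moment_mx_p3_boost//.
rewrite /boost lorentzN /=.
have -> : lorentz v * (1 - - v * 0) = lorentz v by ring.
have -> : lorentz v * (0 - - v * 1) = lorentz v * v by ring.
rewrite -!(mulmxA _ (Dmx _)).
exact: flux_combination (lorentz_sqr v1).
Qed.

End boosted_system.

Theorem theorem6p3 (R : realType) (M : nat) (M_ge1 : (1 <= M)%N)
    (tau : R -> R -> R)
    (tau_gt0 : forall n theta : R, 0 < n -> 0 < theta -> 0 < tau n theta)
    (v : R) (v_lt1 : `|v| < 1)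
    (Omega : set (R * R)) (Omega_open : open Omega)
    (W : R * R -> 'cV[R]_(nmom M))
    (W_diff : forall z, Omega z -> differentiable W z)
    (W_adm : forall z, Omega z -> admissible (W z)) :
  solves tau Omega W <-> solves tau (boost v @` Omega) (boost_field v W).
Proof.
have source_eq z : Omega z ->
    source tau (boost_field v W (boost v z)) = source tau (W z).
  move=> Oz; have [_ u1 _] := W_adm z Oz.
  rewrite /boost_field (boostK v_lt1).
  exact: (source_boost_state M_ge1 tau v_lt1 u1).
split=> [sol _ [z Oz <-]|sol z Oz].
  rewrite (boosted_flux M_ge1 v_lt1 (W_diff z Oz) (W_adm z Oz)) (source_eq z Oz).
  exact: (sol z Oz).
rewrite -(boosted_flux M_ge1 v_lt1 (W_diff z Oz) (W_adm z Oz)) -(source_eq z Oz).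
by apply: sol; exists z.
Qed.
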